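(* Let $G$ be a finite group and suppose $\chi\in\mathrm{Irr}(G)$. Suppose that for every $g\in G$, $\omega_\chi(g)$ is divisible by $|Aut^0_G(g)|$. Then for every $g\in G$ with $\chi(g)\neq 0$, the order of $g$ divides $|G|/\chi(1)$.
   Context: $\mathrm{Irr}(G)$ is the set of irreducible complex characters of $G$. For $g\in G$, $h_g$ is the size of the conjugacy class of $g$ in $G$ and $\omega_\chi(g)=\frac{h_g\chi(g)}{\chi(1)}$ is the central character value (an algebraic integer). Divisibility of an algebraic integer $u$ by a positive integer $m$ means that $u/m$ is an algebraic integer. For an element $g\in G$ of order $n$ and a subgroup $H\subseteq G$, let $g^H$ be the set of $H$-conjugates of $g$ and let $Aut_H(g)=\{r\in\mathbb{Z}/n\mathbb{Z} : g^r\in g^H\}$, a subgroup of $(\mathbb{Z}/n\mathbb{Z})^*$. For each prime $p$ dividing $n$, let $n_{p'}$ be the largest divisor of $n$ prime to $p$, and set $Aut^0_{H,p}(g)=\{m\in Aut_H(g) : m\equiv 1 \bmod pn_{p'}\}$ if $p$ is odd or if $p=2$ and $4\nmid n$, and $Aut^0_{H,2}(g)=\{m\in Aut_H(g) : m\equiv 1\bmod 4n_{2'}\}$ if $p=2$ and $4\mid n$. Finally $Aut^0_H(g)=\prod_{p\mid n}Aut^0_{H,p}(g)$, a subgroup of $Aut_H(g)$. $Aut^0_G(g)$ is the case $H=G$. *)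

(* Defs.v *)
From HB Require Import structures.
From mathcomp Require Import all_boot all_order all_algebra all_fingroup.
From mathcomp Require Import all_solvable all_field all_character.

Set Implicit Arguments.
Unset Strict Implicit.
Unset Printing Implicit Defensive.

Import GroupScope Order.TTheory GRing.Theory Num.Theory.
Local Open Scope ring_scope.

Definition central_char (gT : finGroupType) (G : {group gT}) (chi : 'CF(G))
    (g : gT) : algC :=
  #|g ^: G|%:R * chi g / chi 1%g.

Section LocalAut.

Variables (gT : finGroupType) (H : {group gT}) (g : gT).
Local Notation n := #[g].

(* A residue r with g ^+ r \in g ^: H is invertible mod n, since conjugates   *)
(* have the same order (see autE below), so Aut_H(g) is defined directly      *)
(* inside the unit group of Z/n. For n = 1, 'Z_1 is Z/2 rather than the zero  *)
(* ring, but {unit 'Z_1} is trivial, as is (Z/1)^*.                           *)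
Definition aut : {set {unit 'Z_n}} :=
  [set u : {unit 'Z_n} | (g ^+ (val u : 'Z_n))%g \in g ^: H].

Definition aut0_modulus (p : nat) : nat :=
  if (p == 2%N) && (4 %| n)%N then (4 * n`_2^')%N else (p * n`_p^')%N.

(* For a prime p dividing n, the modulus divides n, so the congruence does    *)
(* not depend on the chosen representative of the residue class.              *)
Definition aut0p (p : nat) : {set {unit 'Z_n}} :=
  [set u in aut | ((val u : 'Z_n) : nat) == 1%N %[mod aut0_modulus p]].

(* The product is that of subsets of the abelian group {unit 'Z_n}.           *)
Definition aut0 : {set {unit 'Z_n}} := (\prod_(p <- primes n) aut0p p)%g.

Lemma conj_expg_coprime r : (g ^+ r)%g \in g ^: H -> coprime n r.
Proof.
case/imsetP=> x _ def_gr.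
have := orderJ g x; rewrite -def_gr orderXgcd => eq_n.
have /eqP := divnK (dvdn_gcdl n r).
by rewrite eq_n -[X in _ == X]muln1 eqn_pmul2l.
Qed.

Lemma expg_Zp m : (g ^+ (inZp m : 'Z_n))%g = (g ^+ m)%g.
Proof.
rewrite /=; have [n_gt1 | n_le1] := ltnP 1 n.
  by rewrite Zp_cast // expg_mod_order.
have -> : g = 1%g by apply/eqP; rewrite -order_eq1 eqn_leq n_le1 order_gt0.
by rewrite !expg1n.
Qed.

Lemma autE r :
  reflect (exists2 u : {unit 'Z_n}, u \in aut & (val u : 'Z_n) = r %[mod n])
          ((g ^+ r)%g \in g ^: H).
Proof.
apply: (iffP idP) => [gr_conj | [u]]; last first.
  rewrite inE => gu_conj def_r.
  by rewrite -expg_mod_order -def_r expg_mod_order.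
have [n_gt1 | n_le1] := ltnP 1 n; last first.
  exists 1%g; first by rewrite inE /= expg1 class_refl.
  have /eqP -> : #[g] == 1%N by rewrite eqn_leq n_le1 order_gt0.
  by rewrite !modn1.
have Ur : (r%:R : 'Z_n) \is a GRing.unit.
  by rewrite unitZpE // conj_expg_coprime.
exists (FinRing.unit 'Z_n Ur); last by rewrite /= val_Zp_nat // modn_mod.
by rewrite inE /= val_Zp_nat // expg_mod_order.
Qed.

Lemma expg_unitM (u v : {unit 'Z_n}) :
  (g ^+ (val (u * v)%g : 'Z_n))%g = ((g ^+ (val u : 'Z_n)) ^+ (val v : 'Z_n))%g.
Proof. by rewrite -expgM; apply: (expg_Zp (_ * _)). Qed.

Lemma aut_group_set : group_set aut.
Proof.
apply/group_setP; split=> [|u v]; first by rewrite inE /= expg1 class_refl.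
rewrite !inE => /imsetP[x Hx gu] /imsetP[y Hy gv].
by rewrite expg_unitM gu -conjXg gv -conjgM memJ_class ?groupM.
Qed.
Canonical aut_group := Group aut_group_set.

End LocalAut.

(* Main.v *)
Require Import Defs.
From HB Require Import structures.
From mathcomp Require Import all_boot all_order all_algebra all_fingroup.
From mathcomp Require Import all_solvable all_field all_character.
From mathcomp Require Import zify ring.

Set Implicit Arguments.
Unset Strict Implicit.
Unset Printing Implicit Defensive.

Import GroupScope Order.TTheory GRing.Theory Num.Theory.
Local Open Scope ring_scope.

(** Let M = |G| / chi(1). It is enough to show, for every prime p, that chi
    vanishes on the set S of those x in G for which the p-part of the order
    of x exceeds the p-part p^b of M. Let r be the sum of |chi(x)|^2 over S,
    divided by |G|. The first orthogonality relation and the fact that 1 lies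
    outside S give 0 <= r < 1, so chi vanishes on S as soon as r is an
    integer. Stability of S under x |-> x^k for k prime to |G| makes r
    rational ([rat_sum_char_norm]); its denominator is then examined one prime
    at a time.

    For a prime q other than p, membership of x in S depends only on the
    q'-part of x, and a theorem in the style of Frobenius
    ([char_q'closed_sum_dvd]) shows that the sum of a character over such a
    union of classes is divisible by the q-part of |G|.

    The prime p is where the hypothesis enters ([galois_block_sum_dvd]). Take x
    in S of order n, let Q be the modulus in the definition of Aut^0_p(x), and
    write n = Q p^l. Cut S into blocks, the block of x being the union of the
    classes of the powers x^m with m = 1 mod Q. The sum of |chi|^2 / chi(1) over
    this block is a Galois trace: the sum over k < p^l of the conjugates, under
    zeta |-> zeta^(1 + Qk), of the product of u = omega_chi(x) / |Aut^0_p(x)|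
    and the complex conjugate of chi(x). The hypothesis says that u is an
    algebraic integer. But u = M chi(x) / (|C_G(x)| |Aut^0_p(x)|), and n divides
    |C_G(x)|, so up to factors prime to p the value chi(x) itself is divisible
    by p^t, where p^(b + t) is the p-part of |C_G(x)| |Aut^0_p(x)| and t >= 1.
    Two facts on Z[zeta_n] finish the count: an element divisible by p^t among
    all algebraic integers is, up to a factor prime to p, divisible by p^t
    inside Z[zeta_n] ([zeval_saturated]), and the trace maps Z[zeta_n] into
    p^l Z[zeta_n] ([trace_progression]). Hence |chi|^2 contributes p^(2t), the
    trace p^l, and the denominator of u removes p^t: the block sum is divisible
    by p^(t + l). As p^2 is at least the p-part of Q, l >= v_p(n) - 2 >= b - 1,
    so t + l >= b. The surplus t >= 1 is what absorbs the modulus 4 at p = 2. *)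

(** * Values of integer polynomials at a complex number *)

(** The image of [zeval z] is the ring Z[z]; keeping the polynomial rather than
    the value lets a Galois automorphism act by changing z alone. *)
Definition zeval (z : algC) (f : {poly int}) : algC := (map_poly intr f).[z].

Fact zeval_is_zmod_morphism z : zmod_morphism (zeval z).
Proof. by move=> f g; rewrite /zeval rmorphB hornerD hornerN. Qed.

Fact zeval_is_monoid_morphism z : monoid_morphism (zeval z).
Proof.
by split=> [|f g]; rewrite /zeval ?rmorph1 ?hornerC // rmorphM hornerM.
Qed.

HB.instance Definition _ z :=
  GRing.isZmodMorphism.Build {poly int} algC (zeval z) (zeval_is_zmod_morphism z).
HB.instance Definition _ z :=
  GRing.isMonoidMorphism.Build {poly int} algC (zeval z) (zeval_is_monoid_morphism z).

Lemma zevalX z : zeval z 'X = z. Proof. by rewrite /zeval map_polyX hornerX. Qed.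

Lemma zevalXn z n : zeval z 'X^n = z ^+ n. Proof. by rewrite rmorphXn /= zevalX. Qed.

Lemma zevalC z (c : int) : zeval z c%:P = c%:~R.
Proof. by rewrite /zeval map_polyC hornerC. Qed.

Lemma zevalE z f : zeval z f = \sum_(i < size f) (f`_i)%:~R * z ^+ i.
Proof.
rewrite -{1}[f]coefK poly_def rmorph_sum /=; apply: eq_bigr => i _.
by rewrite -mul_polyC rmorphM /= zevalC zevalXn.
Qed.

Lemma zeval_comp_Xn z f n : zeval z (f \Po 'X^n) = zeval (z ^+ n) f.
Proof. by rewrite /zeval map_comp_poly horner_comp map_polyXn hornerXn. Qed.

Lemma Aint_zeval z f : z \in Aint -> zeval z f \in Aint.
Proof.
move=> Az; rewrite zevalE; apply: rpred_sum => i _.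
by rewrite rpredM ?rpredX ?Aint_int.
Qed.

Lemma aut_zeval (u : {rmorphism algC -> algC}) z f : u (zeval z f) = zeval (u z) f.
Proof.
by rewrite !zevalE rmorph_sum; apply: eq_bigr => i _; rewrite rmorphM rmorphXn rmorph_int.
Qed.

(** * Ramanujan sums *)

Lemma sum_powers (w : algC) n :
  w ^+ n = 1 -> \sum_(k < n) w ^+ k = if w == 1 then n%:R else 0.
Proof.
move=> wn1; case: eqP => [-> | /eqP w_neq1].
  by rewrite (eq_bigr (fun _ => 1)) => [|i _]; rewrite ?expr1n // sumr_const card_ord.
have := subrX1 w n; rewrite wn1 subrr => /esym/eqP.
by rewrite mulf_eq0 subr_eq0 (negPf w_neq1) => /eqP.
Qed.

Lemma sum_powers_multiples (w : algC) n e :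
  w ^+ n = 1 -> (e %| n)%N ->
  \sum_(k < n | (e %| k)%N) w ^+ k = \sum_(k < n %/ e) (w ^+ e) ^+ k.
Proof.
move=> wn1 e_n; have [n0 | n_gt0] := posnP n.
  by subst n; rewrite div0n !big_ord0.
have e_gt0 : (0 < e)%N by apply: dvdn_gt0 e_n.
have h_ub (k : 'I_(n %/ e)) : (e * k < n)%N by rewrite mulnC -ltn_divRL.
have h'_ub (k : 'I_n) : (k %/ e < n %/ e)%N by rewrite ltn_divLR // divnK.
rewrite (reindex_onto (fun k => Ordinal (h_ub k)) (fun k => Ordinal (h'_ub k))).
  apply: eq_big => [k | k _]; last by rewrite /= exprM.
  by rewrite dvdn_mulr //=; apply/eqP/val_inj; rewrite /= mulKn.
by move=> k e_k; apply: val_inj; rewrite /= mulnC divnK.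
Qed.

(** Inclusion and exclusion, one member of [s] at a time: the indices avoiding q
    are all indices, less those that are multiples of lcm(e, q). The modulus [e]
    is there to make the induction go through. *)
Lemma Cint_sum_powers_sieve (w : algC) n (s : seq nat) e :
    w ^+ n = 1 -> (e %| n)%N -> all (fun q => q %| n)%N s ->
  \sum_(k < n | (e %| k)%N && all (fun q => ~~ (q %| k))%N s) w ^+ k \in Num.int.
Proof.
move=> wn1; elim: s e => [|q s IHs] e e_n.
  move=> _; rewrite (eq_bigl _ _ (fun _ => andbT _)) sum_powers_multiples //.
  rewrite sum_powers; last by rewrite -exprM mulnC divnK.
  by case: ifP; rewrite ?rpred0 ?natr_int.
case/andP=> q_n s_n; have le_n : (lcmn e q %| n)%N by rewrite dvdn_lcm e_n.
have := rpredB (IHs e e_n s_n) (IHs _ le_n s_n).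
rewrite [X in X - _](bigID (fun k : 'I_n => q %| k)%N) /=.
rewrite [X in X + _ - _](eq_bigl _ _ (fun k => andbAC _ _ _)).
rewrite (eq_bigl _ _ (fun k : 'I_n => congr2 andb (dvdn_lcm e q k) erefl)).
rewrite addrC addKr => sum_int; rewrite (eq_bigl _ _ (fun k => andbA _ _ _)).
by rewrite (eq_bigl _ _ (fun k => andbAC _ _ _)).
Qed.

(** These sums carry every rationality argument below: the sum of all conjugates
    of an element of Z[zeta] is an integer combination of them. *)
Lemma Cint_Ramanujan_sum (w : algC) n :
  w ^+ n = 1 -> \sum_(k < n | coprime k n) w ^+ k \in Num.int.
Proof.
have [-> | n_gt0] := posnP n; first by rewrite big_ord0 rpred0.
move=> wn1; rewrite (eq_bigl (fun k : 'I_n =>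
   (1 %| k)%N && all (fun q => ~~ (q %| k))%N (primes n))).
  apply: Cint_sum_powers_sieve => //; apply/allP=> q.
  by rewrite mem_primes => /and3P[].
move=> k; rewrite dvd1n andTb; have [k0 | k_gt0] := posnP k.
  rewrite k0 /coprime gcd0n; case: (ltngtP n 1) => [||->] //; first by case: (n) n_gt0.
  move=> n_gt1; apply/esym/negbTE/allPn; exists (pdiv n); rewrite ?dvdn0 //.
  by rewrite mem_primes pdiv_prime // n_gt0 pdiv_dvd.
rewrite coprime_has_primes // -all_predC; apply: eq_in_all => q.
by rewrite mem_primes => /andP[q_pr _] /=; rewrite mem_primes q_pr k_gt0.
Qed.

(** * Divisibility by p in Z[zeta] and in the algebraic integers *)

Lemma Aint_prime_dvd_expr p (c : int) N v :
    prime p -> v \in Aint -> (c%:~R ^+ N : algC) = p%:R * v ->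
  (p %| `|c|)%N.
Proof.
move=> p_pr Av def_cN; have p_nz : p%:R != 0 :> algC.
  by rewrite pnatr_eq0 -lt0n prime_gt0.
have Dv : v = (c ^+ N)%:~R / p%:R by rewrite rmorphXn /= def_cN mulrC mulKf.
have /intrP[m Dm] : v \is a Num.int.
  by apply: Cint_rat_Aint => //; rewrite Dv rpred_div ?rpred_int ?rpred_nat.
have /eqP : c ^+ N = p%:Z * m.
  by apply: (@intr_inj algC); rewrite rmorphXn /= def_cN Dm rmorphM.
move/eqP/(congr1 absz); rewrite abszX abszM absz_nat => DcN.
have : (p %| `|c| ^ N)%N by rewrite DcN dvdn_mulr.
by rewrite Euclid_dvdX // => /andP[].
Qed.

(** The product is the value at 1 of the cyclotomic polynomial of order p^a, the
    quotient of X^(p q) - 1 by X^q - 1 with q = p^(a - 1), that is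
    1 + X^q + ... + X^((p - 1) q). *)
Lemma prod_coprime_prime_power p a (z : algC) :
    prime p -> (0 < a)%N -> (p ^ a).-primitive_root z ->
  \prod_(k < p ^ a | ~~ (p %| k)%N) (1 - z ^+ k) = p%:R.
Proof.
move=> p_pr a_gt0 pz; have p_gt0 := prime_gt0 p_pr.
set q := (p ^ a.-1)%N; have def_n: (p ^ a = p * q)%N by rewrite -expnS prednK.
have q_gt0 : (0 < q)%N by rewrite expn_gt0 p_gt0.
have zp_prim : q.-primitive_root (z ^+ p).
  have q_n : (q %| p ^ a)%N by rewrite def_n dvdn_mull.
  by have := dvdn_prim_root pz q_n; rewrite def_n mulnK.
have Dprod : \prod_(k < p ^ a | ~~ (p %| k)%N) ('X - (z ^+ k)%:P)
          = \sum_(i < p) 'X^q ^+ i :> {poly algC}.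
  have nz : 'X^q - 1 != 0 :> {poly algC} by rewrite monic_neq0 ?monicXnsubC.
  apply: (mulfI nz); rewrite -subrX1 -exprM mulnC -def_n.
  rewrite -(factor_Xn_sub_1 pz) -(factor_Xn_sub_1 zp_prim) !big_mkord.
  rewrite [RHS](bigID (fun k : 'I_(p ^ a) => (p %| k)%N)) /=; congr (_ * _).
  have h_ub (k : 'I_q) : (p * k < p ^ a)%N by rewrite def_n ltn_pmul2l.
  have h'_ub (k : 'I_(p ^ a)) : (k %/ p < q)%N by rewrite ltn_divLR // mulnC -def_n.
  rewrite [RHS](reindex_onto (fun k => Ordinal (h_ub k)) (fun k => Ordinal (h'_ub k))).
    apply: eq_big => [k | k _]; last by rewrite /= exprM.
    by rewrite dvdn_mulr //=; apply/esym/eqP/val_inj; rewrite /= mulKn.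
  by move=> k e_k; apply: val_inj; rewrite /= mulnC divnK.
have := congr1 (horner^~ 1) Dprod.
rewrite horner_prod horner_sum (eq_bigr (fun k : 'I__ => 1 - z ^+ k)) => [->|k _].
  rewrite (eq_bigr (fun _ => 1)) => [|i _]; last by rewrite !(hornerXn, horner_exp, expr1n).
  by rewrite sumr_const card_ord.
by rewrite hornerXsubC.
Qed.

(** Total ramification: p is a product of factors 1 - z^k, each of which is an
    associate of 1 - z in Z[z], because z is in turn a power of z^k. *)
Lemma uniformizer_prime_power p a (z : algC) :
    prime p -> (0 < a)%N -> (p ^ a).-primitive_root z ->
  exists d g h, [/\ (0 < d)%N, (1 - z) ^+ d = p%:R * zeval z g
     & p%:R = (1 - z) ^+ d * zeval z h].
Proof.
move=> p_pr a_gt0 pz; pose P := fun k : 'I_(p ^ a) => ~~ (p %| k)%N.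
have n_gt0 : (0 < p ^ a)%N by rewrite expn_gt0 prime_gt0.
have zn1 : z ^+ (p ^ a) = 1 by apply: prim_expr_order.
have [g Dg]: exists g, \prod_(k < p ^ a | P k) (1 - z)
                     = \prod_(k < p ^ a | P k) (1 - z ^+ k) * zeval z g.
  elim/big_rec2: _ => [|k x y Pk [g ->]]; first by exists 1; rewrite rmorph1 mulr1.
  have k_gt0 : (0 < k)%N by rewrite lt0n; apply: contraNneq Pk => ->; apply: dvdn0.
  have co_k : coprime k (p ^ a) by rewrite coprime_sym coprimeXl // prime_coprime.
  case/(coprimeP _ k_gt0): co_k => -[u v] /= Duv.
  have Dz : z = z ^+ k ^+ u.
    rewrite -exprM mulnC -[(u * k)%N](@subnK (v * p ^ a)%N); last first.
      by apply: ltnW; rewrite -subn_gt0 Duv.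
    by rewrite Duv exprD mulnC exprM zn1 expr1n mulr1.
  exists (\sum_(i < u) 'X^k ^+ i * g).
  rewrite {1}Dz -opprB subrX1 -mulNr opprB -mulr_suml rmorphM rmorph_sum /=.
  rewrite [in RHS](eq_bigr (fun i : 'I_u => z ^+ k ^+ i)) => [|i _]; last first.
    by rewrite rmorphXn /= zevalXn.
  by rewrite mulrACA.
have [h Dh]: exists h, \prod_(k < p ^ a | P k) (1 - z ^+ k)
                     = \prod_(k < p ^ a | P k) (1 - z) * zeval z h.
  elim/big_rec2: _ => [|k x y Pk [h ->]]; first by exists 1; rewrite rmorph1 mulr1.
  exists (\sum_(i < k) 'X ^+ i * h).
  rewrite -opprB subrX1 -mulNr opprB -mulr_suml rmorphM rmorph_sum /=.
  rewrite [in RHS](eq_bigr (fun i : 'I_k => z ^+ i)) => [|i _]; last by rewrite zevalXn.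
  by rewrite mulrACA.
exists #|P|, g, h; rewrite prodr_const prod_coprime_prime_power // in Dg Dh.
split=> //; apply/card_gt0P.
have n_gt1 : (1 < p ^ a)%N by rewrite -(expn0 p) ltn_exp2l ?prime_gt1.
by exists (Ordinal n_gt1); rewrite unfold_in /P /= dvdn1 neq_ltn prime_gt1 ?orbT.
Qed.

(** The residue ring of Z[z] modulo 1 - z consists of images of integers; this is
    what keeps the residue computations below in Z. *)
Lemma zeval_mod_uniformizer z f :
  exists f', zeval z f = (f.[1])%:~R + (1 - z) * zeval z f'.
Proof.
have /factor_theorem[q Dq]: root (f - (f.[1])%:P) 1 by rewrite /root !hornerE subrr.
exists (- q); rewrite -[in LHS](subrK (f.[1])%:P f) Dq rmorphD rmorphM rmorphB /= zevalX.
by rewrite !zevalC rmorphN mulrN -mulNr opprB addrC mulrC.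
Qed.

(** An element of Z[z] divisible by p among all algebraic integers is divisible
    by p within Z[z]: expand it in powers of the uniformizer 1 - z with coefficients
    in Z. After the coefficients divisible by p are set aside, dividing by the
    power of 1 - z in front of the next one, b, shows that 1 - z divides b; so p
    divides a power of b, hence b. *)
Lemma zeval_saturated_prime_power p a (z : algC) f v t :
    prime p -> (0 < a)%N -> (p ^ a).-primitive_root z ->
    v \in Aint -> zeval z f = p%:R ^+ t * v ->
  exists h, zeval z f = p%:R ^+ t * zeval z h.
Proof.
move=> p_pr a_gt0 pz; have [d [g [h [d_gt0 Dg Dh]]]] := uniformizer_prime_power p_pr a_gt0 pz.
have p_nz : p%:R != 0 :> algC by rewrite pnatr_eq0 -lt0n prime_gt0.
have Az : z \in Aint by apply: Aint_prim_root pz.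
have A1z : 1 - z \in Aint by rewrite rpredB ?Aint1.
have pi_nz : 1 - z != 0.
  by apply: contraNneq p_nz => z1; rewrite Dh z1 expr0n eqn0Ngt d_gt0 mul0r.
have step1 w f0 : w \in Aint -> zeval z f0 = p%:R * w -> exists h0, zeval z f0 = p%:R * zeval z h0.
  move=> Aw Df0.
  (* One power of 1 - z is gained at each step, until (1 - z)^d is divisible by p. *)
  have [al [be Dbe]]: exists al be, zeval z f0 = p%:R * zeval z al + (1 - z) ^+ d * zeval z be.
    elim: {-2}d (leqnn d) => [_ | j IHj lt_jd].
      by exists 0, f0; rewrite rmorph0 mulr0 add0r mul1r.
    have{IHj} [|al [be Df]] := IHj; first exact: ltnW.
    have [be' Dbe] := zeval_mod_uniformizer z be.
    set b := be.[1] in Dbe.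
    have p_b : (p %| `|b|)%N.
      pose y := (1 - z) ^+ (d - j).-1 * zeval z h * (w - zeval z al).
      pose x := y - zeval z be'.
      have Ax : x \in Aint by rewrite !rpredB ?rpredM ?rpredX ?Aint_zeval ?rpredB ?Aint_zeval.
      have Db : b%:~R = (1 - z) * x.
        apply: (mulfI (expf_neq0 j pi_nz)).
        have -> : b%:~R = zeval z be - (1 - z) * zeval z be' by rewrite Dbe addrK.
        have E : (1 - z) ^+ j * zeval z be = (1 - z) ^+ j * (1 - z) * y.
          have ->: (1 - z) ^+ j * zeval z be = p%:R * (w - zeval z al).
            by rewrite mulrBr -Df0 Df [RHS]addrC addKr.
          rewrite {1}Dh /y -exprSr !mulrA -exprD.
          by congr (_ ^+ _ * _ * _); lia.
        by rewrite mulrBr E /x; ring.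
      apply: (@Aint_prime_dvd_expr p b d (zeval z g * x ^+ d) p_pr).
        by rewrite rpredM ?rpredX ?Aint_zeval.
      by rewrite Db exprMn Dg mulrA.
    have [b' Db'] : exists b', b = p%:Z * b'.
      by have /dvdzP[b' ->] : (p%:Z %| b)%Z by []; exists b'; rewrite mulrC.
    exists (al + b'%:P * (1 - 'X) ^+ j), be'.
    rewrite Df Dbe Db' rmorphD !rmorphM /= rmorphXn rmorphB rmorph1 /= zevalX zevalC.
    by rewrite exprS; ring.
  exists (al + g * be); rewrite Dbe Dg rmorphD rmorphM /= mulrDr.
  by rewrite mulrA.
elim: t v => [|t IHt] v Av Df; first by exists f; rewrite mul1r.
have [||h0 Dh0] := IHt (p%:R * v); first by rewrite rpredM ?rpred_nat.
  by rewrite Df exprSr mulrA.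
have [|h1 Dh1] := step1 v h0 Av.
  by apply: (mulfI (expf_neq0 t p_nz)); rewrite -Dh0 Df exprSr mulrA.
by exists h1; rewrite Dh0 Dh1 exprSr mulrA.
Qed.

(** Split z into a root zeta of order p^a and a root xi of order m prime to p.
    Discrete Fourier inversion over the conjugates that fix zeta,
      m f(z) = \sum_(i < m) xi^i \sum_(k prime to m) xi^(- i k) f_k(z),
    where f_k(z) is the conjugate of f(z) with xi replaced by xi^k, has
    coefficients in Z[zeta] because Ramanujan sums are integers. Conjugation
    keeps the divisibility by p^t, so [zeval_saturated_prime_power] applies to
    each coefficient. *)
Lemma zeval_saturated p n (z : algC) f v t :
    prime p -> (p %| n)%N -> n.-primitive_root z ->
    v \in Aint -> zeval z f = p%:R ^+ t * v ->
  exists h, (n`_p^')%N%:R * zeval z f = p%:R ^+ t * zeval z h.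
Proof.
move=> p_pr p_n pz Av Df; have n_gt0 := prim_order_gt0 pz; set m := (n`_p^')%N.
pose a := logn p n; have a_gt0 : (0 < a)%N by rewrite logn_gt0 mem_primes p_pr n_gt0.
have Dn : n = (p ^ a * m)%N by rewrite -p_part partnC.
have q_gt0 : (0 < p ^ a)%N by rewrite expn_gt0 prime_gt0.
have m_gt0 : (0 < m)%N by rewrite part_gt0.
have co_qm : coprime (p ^ a) m.
  by rewrite -p_part (pnat_coprime (part_pnat _ _)) ?part_pnat.
have p_zeta : (p ^ a).-primitive_root (z ^+ m).
  have := dvdn_prim_root pz (_ : p ^ a %| n)%N.
  by rewrite {2}Dn mulKn //; apply; rewrite Dn dvdn_mulr.
have p_xi : m.-primitive_root (z ^+ (p ^ a)).
  have := dvdn_prim_root pz (_ : m %| n)%N.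
  by rewrite {2}Dn mulnK //; apply; rewrite Dn dvdn_mull.
(* zeta and xi are kept abstract, so that powers of them are not merged into powers of z. *)
have [zeta Dzeta] : exists zeta : algC, z ^+ m = zeta by exists (z ^+ m).
have [xi Dxi] : exists xi : algC, z ^+ (p ^ a) = xi by exists (z ^+ (p ^ a)).
rewrite Dzeta in p_zeta; rewrite Dxi in p_xi.
have xi_nz : xi != 0 by rewrite (prim_root_eq0 p_xi) -lt0n.
have [c [d Dz]]: exists c d, z = zeta ^+ c * xi ^+ d.
  have := co_qm; rewrite coprime_sym => /(coprimeP _ m_gt0)[[c v1] /= Dcv].
  exists c, (v1 * m.-1)%N; apply: (mulIf (expf_neq0 v1 xi_nz)).
  rewrite -mulrA -exprD -mulnSr prednK // [xi ^+ (v1 * m)]exprM exprAC.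
  rewrite (prim_expr_order p_xi) expr1n mulr1 -Dzeta -Dxi -!exprM -exprS.
  by congr (_ ^+ _); lia.
pose R i j : int := Num.floor (\sum_(k < m | coprime k m) (xi ^+ ((m - i) + d * j)) ^+ k).
have DR i j : (R i j)%:~R = \sum_(k < m | coprime k m) (xi ^+ ((m - i) + d * j)) ^+ k.
  by rewrite floorK // Cint_Ramanujan_sum // exprAC (prim_expr_order p_xi) expr1n.
(* The exponent m - i stands for - i, as xi has order m. *)
pose g i := \sum_(j < size f) (f`_j * R i j)%:P * 'X^(c * j).
have Dg i : zeval zeta (g i)
    = \sum_(k < m | coprime k m) xi ^+ ((m - i) * k) * zeval (zeta ^+ c * xi ^+ (d * k)) f.
  rewrite rmorph_sum [RHS](eq_bigr _ (fun k _ => congr1 _ (zevalE _ f))) /=.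
  rewrite [RHS](eq_bigr _ (fun k _ => mulr_sumr _ _ _ _)) exchange_big /=.
  apply: eq_bigr => j _; rewrite rmorphM /= zevalC zevalXn rmorphM /= DR.
  rewrite mulr_sumr mulr_suml; apply: eq_bigr => k _.
  rewrite exprMn -!exprM mulnDl exprD (_ : (d * j * k)%N = (d * k * j)%N); last by lia.
  by ring.
have conj_f k : coprime k m -> exists2 w, w \in Aint &
    zeval (zeta ^+ c * xi ^+ (d * k)) f = p%:R ^+ t * w.
  (* The automorphism fixing zeta and raising xi to the power k. *)
  move=> co_km; pose K := chinese (p ^ a) m 1 k.
  have modKl : K = 1 %[mod p ^ a] by apply: chinese_modl.
  have modKr : K = k %[mod m] by apply: chinese_modr.
  have co_K : coprime K n.
    by rewrite Dn coprimeMr -coprime_modl modKl coprime_modl coprime1n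
             -coprime_modl modKr coprime_modl.
  have [u Du] := Qn_aut_exists co_K; exists (u v); first by rewrite Aint_aut.
  have -> : p%:R ^+ t * u v = u (zeval z f) by rewrite Df rmorphM rmorphXn rmorph_nat.
  rewrite aut_zeval Du ?(prim_expr_order pz) // [in RHS]Dz exprMn -!exprM; congr (zeval (_ * _) f).
    by rewrite mulnC !exprM -(prim_expr_mod p_zeta K) modKl (prim_expr_mod p_zeta) expr1.
  by rewrite mulnC [in RHS]mulnC !exprM -(prim_expr_mod p_xi K) modKr (prim_expr_mod p_xi).
have [w Dw]: exists w : 'I_m -> algC, forall k : 'I_m, coprime k m ->
    w k \in Aint /\ zeval (zeta ^+ c * xi ^+ (d * k)) f = p%:R ^+ t * w k.
  apply: (@fin_all_exists _ (fun=> algC) (fun (k : 'I_m) wk => coprime k m ->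
    wk \in Aint /\ zeval (zeta ^+ c * xi ^+ (d * k)) f = p%:R ^+ t * wk)) => k.
  have [/conj_f[wk Awk Dwk] | nco] := boolP (coprime k m); first by exists wk.
  by exists 0.
have Axi : xi \in Aint by apply: Aint_prim_root p_xi.
have [h Dh]: exists h : 'I_m -> {poly int}, forall i : 'I_m,
    zeval zeta (g i) = p%:R ^+ t * zeval zeta (h i).
  apply: (@fin_all_exists _ (fun=> {poly int})
    (fun (i : 'I_m) hi => zeval zeta (g i) = p%:R ^+ t * zeval zeta hi)) => i.
  pose v1 := \sum_(k < m | coprime k m) xi ^+ ((m - i) * k) * w k.
  apply: (@zeval_saturated_prime_power p a zeta (g i) v1) => //.
    by apply: rpred_sum => k /Dw[Awk _]; rewrite rpredM ?rpredX.
  by rewrite Dg mulr_sumr; apply: eq_bigr => k /Dw[_ ->]; ring.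
exists (\sum_(i < m) 'X^(p ^ a * i) * (h i \Po 'X^m)).
rewrite rmorph_sum mulr_sumr /=.
rewrite [RHS](eq_bigr (fun i : 'I_m => xi ^+ i * zeval zeta (g i))) => [|i _]; last first.
  by rewrite rmorphM /= zevalXn zeval_comp_Xn exprM Dxi Dzeta Dh; ring.
under [RHS]eq_bigr do rewrite Dg mulr_sumr.
(* The term k = 1 is the only one that survives; it is written 1 %% m to include m = 1. *)
have m1_ub : (1 %% m < m)%N by rewrite ltn_mod.
have co_m1 : coprime (1 %% m) m by rewrite coprime_modl coprime1n.
have xi_m1 : xi ^+ (1 %% m) = xi by rewrite (prim_expr_mod p_xi) expr1.
rewrite exchange_big (bigD1 (Ordinal m1_ub)) //= [X in _ + X]big1 => [|k /andP[_ k_neq1]].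
  rewrite addr0 (eq_bigr (fun _ => zeval z f)) => [|i _].
    by rewrite sumr_const card_ord mulr_natl.
  rewrite [(d * _)%N]mulnC [(_ * (1 %% m))%N]mulnC !exprM xi_m1 -Dz mulrA -exprD.
  by rewrite subnKC ?(prim_expr_order p_xi) ?mul1r // ltnW.
rewrite (eq_bigr (fun i : 'I_m => (xi / xi ^+ k) ^+ i * zeval (zeta ^+ c * xi ^+ (d * k)) f)).
  rewrite -mulr_suml sum_powers; last first.
    by rewrite expr_div_n exprAC (prim_expr_order p_xi) expr1n divr1.
  case: eqP; last by rewrite mul0r.
  move/divr1_eq/eqP; rewrite -{1}(expr1 xi) (eq_prim_root_expr p_xi) => /eqP modk.
  by case/eqP: k_neq1; apply: val_inj; rewrite /= modk modn_small.
move=> i _; rewrite mulrA; congr (_ * _); rewrite expr_div_n; apply/esym.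
apply: (canLR (mulfK _)); first by rewrite !expf_neq0 ?xi_nz.
rewrite -mulrA [_ ^+ k ^+ i]exprAC -!exprM -exprD -mulnDl subnK; last exact: ltnW.
by rewrite exprM (prim_expr_order p_xi) expr1n mulr1.
Qed.

(** On each power z^j the sum is geometric with ratio z^(Q j), an L-th root of
    unity, so it is either L z^j or 0. *)
Lemma trace_progression (z : algC) Q L f :
    z ^+ (Q * L) = 1 ->
  exists h, \sum_(k < L) zeval (z ^+ (1 + Q * k)) f = L%:R * zeval z h.
Proof.
move=> zQL1; exists (\sum_(j < size f | z ^+ (Q * j) == 1) (f`_j)%:P * 'X^j).
rewrite (eq_bigr _ (fun k _ => zevalE _ f)) exchange_big rmorph_sum mulr_sumr /=.
rewrite [RHS]big_mkcond /=; apply: eq_bigr => j _.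
rewrite -mulr_sumr rmorphM /= zevalC zevalXn.
rewrite (eq_bigr (fun k : 'I_L => z ^+ j * (z ^+ (Q * j)) ^+ k)); last first.
  by move=> k _; rewrite -!exprM -exprD; congr (_ ^+ _); lia.
rewrite -mulr_sumr sum_powers; first by case: ifP => _; ring.
by rewrite -exprM mulnAC exprM zQL1 expr1n.
Qed.

(** * Character values on a cyclic subgroup *)

(** Restricted to <[x]>, the character is a sum of linear characters, each
    sending x to a power of z. One polynomial serves all powers of x, so that
    x |-> x^k is mirrored by z |-> z^k. *)
Lemma char_expg_zeval (gT : finGroupType) (G : {group gT}) (chi : 'CF(G)) x z :
    chi \is a character -> x \in G -> #[x]%g.-primitive_root z ->
  exists f, forall k, chi (x ^+ k)%g = zeval (z ^+ k) f.
Proof.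
move=> Nchi Gx pz; pose C := <[x]>%G.
have sCG : C \subset G by rewrite cycle_subG.
have Nres : 'Res[C] chi \is a character by apply: cfRes_char.
have [r Dr] := char_sum_irr Nres.
have lin_i (i : Iirr C) : 'chi_i \is a linear_char.
  by apply: irr_cyclic_lin; apply: cycle_cyclic.
have /fin_all_exists[s Ds] (i : Iirr C) : exists s : nat, 'chi_i x = z ^+ s.
  have [|s ->] := prim_rootP pz (_ : 'chi_i x ^+ #[x]%g = 1); last by exists s.
  by rewrite -lin_charX ?cycle_id // expg_order lin_char1.
exists (\sum_(i <- r) 'X^(s i)) => k.
rewrite -(cfResE chi sCG) ?mem_cycle // Dr sum_cfunE rmorph_sum; apply: eq_bigr => i _.
by rewrite lin_charX ?cycle_id //= zevalXn Ds exprAC.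
Qed.

(** Complex conjugation raises the powers of z to the power #[x] - 1. *)
Lemma char_norm_zeval (gT : finGroupType) (G : {group gT}) (chi : 'CF(G)) x z f :
    chi \is a character ->
    (forall k, chi (x ^+ k)%g = zeval (z ^+ k) f) ->
  forall k, `|chi (x ^+ k)%g| ^+ 2 = zeval (z ^+ k) (f * (f \Po 'X^(#[x]%g.-1))).
Proof.
move=> Nchi Df k; rewrite normCK -char_inv // rmorphM /= zeval_comp_Xn -exprM -!Df.
by rewrite -expgVn invg_expg -expgM mulnC.
Qed.

(** * Blocks of powers congruent to 1 *)

Section GaloisBlocks.

Variables (gT : finGroupType) (G : {group gT}) (p : nat).
Hypothesis p_pr : prime p.

(** The bound on [l] covers both shapes of the modulus: its p-part is p, or 4
    when 4 divides the order of x. *)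
Lemma aut0_modulusP (x : gT) :
    (p %| #[x]%g)%N ->
  exists2 l, #[x]%g = (aut0_modulus x p * p ^ l)%N
     & (p %| aut0_modulus x p)%N && (logn p #[x]%g <= l.+2)%N.
Proof.
move=> p_x; rewrite /aut0_modulus.
have Dn := partnC p (order_gt0 x); rewrite p_part in Dn.
have a_gt0 : (0 < logn p #[x]%g)%N by rewrite logn_gt0 mem_primes p_pr order_gt0.
case: ifP => [/andP[/eqP Dp x4] | _]; last first.
  exists (logn p #[x]%g).-1; last by rewrite dvdn_mulr //=; lia.
  by rewrite -{1}Dn -[in LHS](prednK a_gt0) expnS; lia.
subst p; have a_gt1 : (2 <= logn 2 #[x]%g)%N by rewrite -pfactor_dvdn.
exists (logn 2 #[x]%g - 2)%N; last by rewrite dvdn_mulr //=; lia.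
by rewrite -{1}Dn -[in LHS](subnK a_gt1) expnD; lia.
Qed.

(** The order of x and its modulus have the same prime divisors. *)
Lemma coprime_modulus (x : gT) m :
    (p %| #[x]%g)%N -> m = 1 %[mod aut0_modulus x p] -> coprime m #[x]%g.
Proof.
move=> p_x m1; have [l -> /andP[p_Q _]] := aut0_modulusP p_x.
have co_mQ : coprime m (aut0_modulus x p) by rewrite -coprime_modl m1 coprime_modl coprime1n.
by rewrite coprimeMr co_mQ coprimeXr // (coprime_dvdr p_Q).
Qed.

(** The classes of the Galois conjugates of x over the cyclotomic field of level
    [aut0_modulus x p]. Exponents below the order of x suffice when p divides
    that order, since the modulus then divides it. *)
Definition galois_block (x : gT) : {set gT} :=
  [set y in G | [exists m : 'I_#[x]%g,
     (m == 1%N %[mod aut0_modulus x p]) && (y \in (x ^+ m)%g ^: G)]].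

Lemma galois_blockP x y :
    x \in G -> (p %| #[x]%g)%N ->
  reflect (exists2 m : nat, m = 1 %[mod aut0_modulus x p] & y \in (x ^+ m)%g ^: G)
          (y \in galois_block x).
Proof.
move=> Gx p_x; apply: (iffP idP) => [|[m m1 ym]].
  by rewrite inE => /andP[_ /existsP[m /andP[/eqP m1 ym]]]; exists m.
rewrite inE; apply/andP; split.
  by apply: subsetP ym; rewrite class_subG ?groupX.
apply/existsP; exists (Ordinal (ltn_pmod m (order_gt0 x))); rewrite /= expg_mod_order ym andbT.
have [l Dn _] := aut0_modulusP p_x.
by rewrite modn_dvdm ?m1 // Dn dvdn_mulr.
Qed.

Lemma galois_block_order x y :
  x \in G -> (p %| #[x]%g)%N -> y \in galois_block x -> #[y]%g = #[x]%g.
Proof.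
move=> Gx p_x /(galois_blockP _ Gx p_x)[m m1 /imsetP[g Gg ->]].
rewrite orderJ; have := coprime_modulus p_x m1.
by rewrite coprime_sym -generator_coprime /generator /order => /eqP <-.
Qed.

Lemma galois_block_refl x : x \in G -> (p %| #[x]%g)%N -> x \in galois_block x.
Proof. by move=> Gx p_x; apply/galois_blockP=> //; exists 1%N; rewrite ?expg1 ?class_refl. Qed.

(** Blocks partition the elements of order divisible by p: they only involve
    exponents invertible modulo the common order of their elements. *)
Lemma galois_block_eq x y :
  x \in G -> (p %| #[x]%g)%N -> y \in galois_block x -> galois_block y = galois_block x.
Proof.
move=> Gx p_x xy; have Dy := galois_block_order Gx p_x xy.
have Gy : y \in G by move: xy; rewrite inE => /andP[].
have p_y : (p %| #[y]%g)%N by rewrite Dy.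
have DQ : aut0_modulus y p = aut0_modulus x p by rewrite /aut0_modulus Dy.
have [m m1 /imsetP[g Gg Dyx]] := galois_blockP _ Gx p_x xy.
have [l Dn _] := aut0_modulusP p_x.
have co_mn := coprime_modulus p_x m1.
have [m' Dm'] : exists m', (m * m' = 1 %[mod #[x]%g])%N.
  exists (m ^ (totient #[x]%g).-1)%N; rewrite -expnS prednK ?totient_gt0 //.
  exact: Euler_exp_totient.
have m'1 : m' = 1 %[mod aut0_modulus x p].
  have Q_n : (aut0_modulus x p %| #[x]%g)%N by rewrite Dn dvdn_mulr.
  have := congr1 (modn^~ (aut0_modulus x p)) Dm'.
  by rewrite !modn_dvdm // -modnMml m1 modnMml mul1n.
have yX k : (y ^+ k)%g ^: G = (x ^+ (m * k))%g ^: G.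
  by rewrite Dyx -conjXg classGidl // expgM.
apply/setP=> w; apply/galois_blockP/galois_blockP; rewrite ?DQ // => -[k k1 wk].
  exists (m * k)%N; first by rewrite -modnMml m1 modnMml mul1n.
  by rewrite -yX.
exists (m' * k)%N; first by rewrite -modnMml m'1 modnMml mul1n.
by rewrite yX mulnA expgM -[(x ^+ (m * m'))%g]expg_mod_order Dm' expg_mod_order expg1.
Qed.

(** The intersection of this subgroup with [aut] is [aut0p], and the index of that
    intersection is the number of classes in a block. *)
Definition progression_units (x : gT) : {set {unit 'Z_#[x]%g}} :=
  [set u | ((val u : 'Z_#[x]%g) : nat) == 1%N %[mod aut0_modulus x p]].

Section OneBlock.

Variable x : gT.
Hypotheses (Gx : x \in G) (p_x : (p %| #[x]%g)%N).

Let n_gt1 : (1 < #[x]%g)%N.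
Proof. by apply: leq_trans (prime_gt1 p_pr) (dvdn_leq _ p_x); apply: order_gt0. Qed.

Let Q_n : (aut0_modulus x p %| #[x]%g)%N.
Proof. by have [l Dn _] := aut0_modulusP p_x; rewrite Dn dvdn_mulr. Qed.

Lemma val_mul_unit_Zp (u v : {unit 'Z_#[x]%g}) :
  (val (u * v)%g : 'Z_#[x]%g) = ((val u : 'Z_#[x]%g) * (val v : 'Z_#[x]%g) %% #[x]%g)%N :> nat.
Proof. by rewrite /=; congr (_ %% _)%N; apply: Zp_cast. Qed.

Lemma progression_units_group_set : group_set (progression_units x).
Proof.
apply/group_setP; split=> [|u v]; rewrite !inE // => /eqP u1 /eqP v1.
by rewrite val_mul_unit_Zp modn_dvdm // -modnMm u1 v1 modnMm.
Qed.

Lemma aut0pE : aut0p G x p = Defs.aut G x :&: progression_units x.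
Proof. by apply/setP=> u; rewrite !inE. Qed.

Lemma aut0p_group_set : group_set (aut0p G x p).
Proof.
by rewrite aut0pE; apply: (group_setI (Defs.aut_group G x) (Group progression_units_group_set)).
Qed.

Lemma card_class_expg (u : {unit 'Z_#[x]%g}) :
  u \in progression_units x ->
  #|(x ^+ (val u : 'Z_#[x]%g))%g ^: G| = #|x ^: G|.
Proof.
rewrite inE => /eqP/(coprime_modulus p_x).
rewrite coprime_sym -generator_coprime => /eqP Dx.
by rewrite -!index_cent1 -(cent_cycle x) Dx cent_cycle.
Qed.

(** As every prime divisor of the order divides the modulus, all of the residues
    1 + Q k are units. *)
Lemma sum_progression_units (F : gT -> algC) l :
    #[x]%g = (aut0_modulus x p * p ^ l)%N ->
  \sum_(u in progression_units x) F (x ^+ (val u : 'Z_#[x]%g))%g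
    = \sum_(k < p ^ l) F (x ^+ (1 + aut0_modulus x p * k))%g.
Proof.
move=> Dn; set Q := aut0_modulus x p in Dn *.
have p_Q : (p %| Q)%N by have [? _ /andP[]] := aut0_modulusP p_x.
have Q_gt1 : (1 < Q)%N.
  apply: leq_trans (prime_gt1 p_pr) (dvdn_leq _ p_Q).
  by rewrite lt0n; apply: contraTneq n_gt1 => Q0; rewrite Dn Q0.
have val_lt (k : 'I_(p ^ l)) : (1 + Q * k < #[x]%g)%N.
  rewrite Dn; apply: (@leq_trans (Q + Q * k)%N); first by rewrite ltn_add2r.
  by rewrite -mulnS leq_mul2l ltn_ord orbT.
have h_unit (k : 'I_(p ^ l)) : ((1 + Q * k)%:R : 'Z_#[x]%g) \is a GRing.unit.
  rewrite unitZpE // coprime_sym (coprime_modulus p_x) //.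
  by rewrite -/Q addnC mulnC modnMDl.
pose h k : {unit 'Z_#[x]%g} := FinRing.Unit (h_unit k).
have val_h k : (val (h k) : 'Z_#[x]%g) = (1 + Q * k)%N :> nat.
  by rewrite /= val_Zp_nat // modn_small.
have h'_ub (u : {unit 'Z_#[x]%g}) : ((val u : 'Z_#[x]%g).-1 %/ Q < p ^ l)%N.
  rewrite ltn_divLR ?(ltnW Q_gt1) // mulnC -Dn.
  apply: leq_ltn_trans (leq_pred _) (leq_trans (ltn_ord _) _).
  by rewrite Zp_cast.
rewrite (reindex_onto h (fun u => Ordinal (h'_ub u))) => [|u].
  apply: eq_big => [k | k _]; last by rewrite val_h.
  have -> : Ordinal (h'_ub (h k)) = k.
    by apply: val_inj; rewrite [LHS]/= val_h add1n /= mulKn // ltnW.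
  by rewrite eqxx andbT inE val_h -/Q addnC mulnC modnMDl eqxx.
rewrite inE -/Q => /eqP u1; apply/val_inj/val_inj; apply: etrans (val_h _) _.
rewrite [nat_of_ord (Ordinal _)]/=.
have := divn_eq (val u : 'Z_#[x]%g) Q; rewrite u1 modn_small // => Du.
by rewrite {1}Du addn1 /= mulnK ?(ltnW Q_gt1) // {2}Du addnC mulnC.
Qed.

(** The exponents that bring x to the class of y form a coset of [aut0p]. *)
Lemma card_galois_block_fibre y :
  y \in galois_block x ->
  #|[set u in progression_units x | y \in (x ^+ (val u : 'Z_#[x]%g))%g ^: G]|
     = #|aut0p G x p|.
Proof.
move=> xy; pose K := Group progression_units_group_set.
have [u0 Ku0 yu0]: exists2 u0, u0 \in K & y \in (x ^+ (val u0 : 'Z_#[x]%g))%g ^: G.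
  have [m m1 ym] := galois_blockP _ Gx p_x xy.
  have co_m := coprime_modulus p_x m1.
  have Um : (m%:R : 'Z_#[x]%g) \is a GRing.unit by rewrite unitZpE // coprime_sym.
  have val_u : (val (FinRing.Unit Um) : 'Z_#[x]%g) = (m %% #[x]%g)%N :> nat.
    by rewrite /= val_Zp_nat.
  exists (FinRing.Unit Um); last by rewrite val_u expg_mod_order.
  rewrite inE val_u; have [l -> _] := aut0_modulusP p_x.
  by rewrite modn_dvdm ?dvdn_mulr // m1.
have conjX (z w : gT) k : z \in w ^: G -> (z ^+ k)%g \in (w ^+ k)%g ^: G.
  by case/imsetP=> g Gg ->; rewrite -conjXg memJ_class.
rewrite -[RHS](card_rcoset _ u0) aut0pE; apply: eq_card => u.
have memK : (u * u0^-1 \in progression_units x)%g = (u \in progression_units x).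
  exact: (@groupMr _ K _ _ (groupVr Ku0)).
rewrite mem_rcoset in_setI memK.
rewrite [RHS]andbC in_set; congr (_ && _); rewrite [RHS]in_set.
apply/idP/idP=> [/class_eqP Du | uu0]; last first.
  have := conjX _ _ (val u0 : 'Z_#[x]%g) uu0.
  by rewrite -expg_unitM mulgKV -(class_eqP yu0) => /class_eqP ->; apply: class_refl.
have := conjX _ _ (val u0^-1%g : 'Z_#[x]%g)
  (_ : (x ^+ (val u : 'Z_#[x]%g))%g \in (x ^+ (val u0 : 'Z_#[x]%g))%g ^: G).
by rewrite -!expg_unitM mulgV /= expg1 -(class_eqP yu0) Du class_refl; apply.
Qed.

(** Double counting of the pairs (u, y) with y conjugate to x^u: each class has as
    many elements as that of x, and each y occurs once for each element of a
    coset of [aut0p]. *)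
Lemma sum_galois_block (F : gT -> algC) l :
    #[x]%g = (aut0_modulus x p * p ^ l)%N ->
    {in G &, forall y g, F (y ^ g)%g = F y} ->
  #|aut0p G x p|%:R * (\sum_(y in galois_block x) F y)
    = #|x ^: G|%:R * \sum_(k < p ^ l) F (x ^+ (1 + aut0_modulus x p * k))%g.
Proof.
move=> Dn FG; rewrite -(sum_progression_units F Dn).
rewrite !mulr_sumr [RHS](eq_bigr (fun u => \sum_(y in (x ^+ (val u : 'Z_#[x]%g))%g ^: G) F y)).
  rewrite (exchange_big_dep (mem (galois_block x))) /= => [|u y Ku yu]; last first.
    apply/(galois_blockP _ Gx p_x); exists (val u : 'Z_#[x]%g) => //.
    by move: Ku; rewrite inE => /eqP.
  apply: eq_bigr => y xy; rewrite sumr_const -[RHS]mulr_natl -(card_galois_block_fibre xy).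
  by congr (_%:R * _); apply: eq_card => u; rewrite in_set [RHS]unfold_in.
move=> u Ku; rewrite -(card_class_expg Ku).
rewrite [RHS](eq_bigr (fun _ => F (x ^+ (val u : 'Z_#[x]%g))%g)) => [|_ /imsetP[g Gg ->]].
  by rewrite sumr_const mulr_natl.
by rewrite FG ?groupX.
Qed.

End OneBlock.

End GaloisBlocks.

(** In an abelian group a product of subgroups is a subgroup containing each of
    them, so Lagrange applies. *)
Lemma card_aut0p_dvd (gT : finGroupType) (G : {group gT}) p (x : gT) :
  prime p -> (p %| #[x]%g)%N -> (#|aut0p G x p| %| #|aut0 G x|)%N.
Proof.
move=> p_pr p_x; have p_s : p \in primes #[x]%g by rewrite mem_primes p_pr order_gt0.
have pr_s : all (fun q => prime q && (q %| #[x]%g)%N) (primes #[x]%g).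
  by apply/allP=> q; rewrite mem_primes => /and3P[-> _ ->].
rewrite /aut0; move: (primes _) p_s pr_s => s p_s pr_s.
have [A [DA sA]] : exists A : {group {unit 'Z_#[x]%g}},
    (\prod_(q <- s) aut0p G x q)%g = A /\ {in s, forall q, aut0p G x q \subset A}.
  elim: s pr_s {p_s} => [|q s IHs] /=; first by exists 1%G; rewrite big_nil.
  case/andP=> /andP[q_pr q_x] /IHs[A [DA sA]].
  pose B := Group (aut0p_group_set G q_pr q_x).
  exists (B <*> A)%G; rewrite big_cons DA; split.
    apply/esym/(@comm_joingE _ B A).
    by apply: centC; apply/centsP=> u _ v _; apply: unit_Zp_mulgC.
  move=> r /predU1P[-> | /sA sr]; first exact: (joing_subl B A).
  exact: subset_trans sr (joing_subr B A).
by rewrite DA -[aut0p _ _ _]/(gval (Group (aut0p_group_set G p_pr p_x))) cardSg ?sA.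
Qed.

(** * Divisibility of block sums at p *)

Lemma prime_ndvd_p'part p n : prime p -> ~~ (p %| n`_p^')%N.
Proof.
move=> p_pr; rewrite -prime_coprime //.
by apply: pnat_coprime (pnat_id p_pr) (part_pnat _ _).
Qed.

(** Integrality of omega_chi(x) / |Aut^0_p(x)| becomes divisibility of chi(x) by
    p^t, which counts twice in |chi(x)|^2; the denominator takes back one of the
    two factors p^t, and the trace adds p^l. The factor [e] collects the parts
    prime to p, harmless for divisibility by p^b. *)
Lemma galois_block_sum_dvd (gT : finGroupType) (G : {group gT}) (chi : 'CF(G))
    (p M : nat) (x : gT) :
    prime p -> chi \in irr G -> #|G|%:R / chi 1%g = M%:R -> x \in G ->
    (#|aut0 G x|%:R %| central_char chi x)%A ->
    (logn p M < logn p #[x]%g)%N ->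
  exists e v, [/\ ~~ (p %| e)%N, v \in Aint
    & e%:R * (\sum_(y in galois_block G p x) `|chi y| ^+ 2 / chi 1%g) = p%:R ^+ logn p M * v].
Proof.
move=> p_pr irr_chi DM Gx aut_dvd lt_ba.
have Nchi : chi \is a character by have /irrP[i ->] := irr_chi; apply: irr_char.
have chi1_nz : chi 1%g != 0 by have /irrP[i ->] := irr_chi; apply: irr1_neq0.
have M_gt0 : (0 < M)%N.
  by rewrite lt0n -(pnatr_eq0 algC) -DM mulf_neq0 ?invr_eq0 ?neq0CG.
have p_x : (p %| #[x]%g)%N.
  by move: (leq_ltn_trans (leq0n _) lt_ba); rewrite logn_gt0 mem_primes => /and3P[].
have p_nz : p%:R != 0 :> algC by rewrite pnatr_eq0 -lt0n prime_gt0.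
set n := #[x]%g in lt_ba p_x *; set b := logn p M in lt_ba *.
have n_gt0 : (0 < n)%N by apply: order_gt0.
(* Cardinals are named through equations, which keeps [ring] and [field] from unfolding them. *)
have [aut0c Dac] : exists k, k = #|aut0p G x p| by eexists.
have [c Dc] : exists k, k = #|'C_G[x]| by eexists.
have aut0c_gt0 : (0 < aut0c)%N.
  by rewrite Dac -[aut0p _ _ _]/(gval (Group (aut0p_group_set G p_pr p_x))) cardG_gt0.
have c_gt0 : (0 < c)%N by rewrite Dc cardG_gt0.
have le_aD : (logn p n <= logn p (aut0c * c))%N.
  apply: dvdn_leq_log; first by rewrite muln_gt0 aut0c_gt0.
  by rewrite dvdn_mull // Dc /n -[#[x]%g]/#|<[x]>| cardSg // subcent1_cycle_sub.
have [t Dt] : exists t, t = (logn p (aut0c * c) - b)%N by eexists.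
have t_gt0 : (0 < t)%N by rewrite Dt subn_gt0 (leq_trans lt_ba).
have [M' p'M' DM'] : exists2 M', ~~ (p %| M')%N & M = (p ^ b * M')%N.
  by exists (M`_p^')%N; rewrite ?prime_ndvd_p'part // -p_part partnC.
have [D' p'D' DD'] : exists2 D', ~~ (p %| D')%N & (aut0c * c = p ^ b * p ^ t * D')%N.
  exists ((aut0c * c)`_p^')%N; rewrite ?prime_ndvd_p'part //.
  rewrite -expnD Dt subnKC; last by rewrite (leq_trans _ le_aD) // ltnW.
  by rewrite -p_part partnC ?muln_gt0 ?aut0c_gt0.
have card_cl : #|x ^: G|%:R * c%:R = #|G|%:R :> algC.
  by rewrite Dc -natrM -index_cent1 mulnC Lagrange ?subsetIl.
(* u = omega_chi(x) / |Aut^0_p(x)|, with denominators cleared up to p^t. *)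
have [u Au Du] : exists2 u, u \in Aint & M'%:R * chi x = p%:R ^+ t * (D'%:R * u).
  exists (central_char chi x / aut0c%:R).
    have /dvdnP[k Dk] := card_aut0p_dvd G p_pr p_x.
    move: aut_dvd; rewrite /dvdA; case: eqP => [_ /eqP-> | /eqP aut_nz].
      by rewrite mul0r Aint0.
    rewrite Dk natrM -Dac => Aw; rewrite -[X in X \in _](mulfK aut_nz).
    rewrite Dk natrM -Dac; have k_nz : k%:R != 0 :> algC.
      by apply: contraNneq aut_nz; rewrite Dk natrM => ->; rewrite mul0r.
    have ac_nz : aut0c%:R != 0 :> algC by rewrite pnatr_eq0 -lt0n.
    have -> : central_char chi x / aut0c%:R * (k%:R * aut0c%:R) / (k%:R * aut0c%:R)
      = central_char chi x / (k%:R * aut0c%:R) * k%:R by field; rewrite ac_nz k_nz.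
    by rewrite rpredM ?rpred_nat.
  apply: (mulfI (expf_neq0 b p_nz)).
  transitivity (M%:R * chi x); first by rewrite DM' natrM natrX; ring.
  transitivity (aut0c%:R * c%:R * (central_char chi x / aut0c%:R)); last first.
    by rewrite -natrM DD' !natrM !natrX; ring.
  rewrite -DM -card_cl /central_char; field.
  by rewrite chi1_nz pnatr_eq0 -lt0n aut0c_gt0.
have [z pz] := C_prim_root_exists n_gt0.
have [f Df] := char_expg_zeval Nchi Gx pz.
have Df1 : zeval z (f *+ M') = p%:R ^+ t * (D'%:R * u).
  by rewrite raddfMn -Du -(expg1 x) Df expr1 mulr_natl.
have [|h Dh] := zeval_saturated p_pr p_x pz _ Df1; first by rewrite rpredM ?rpred_nat.
have zeval_M' : zeval z (f *+ M') = M'%:R * zeval z f by rewrite raddfMn mulr_natl.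
set m := (n`_p^')%N in Dh; rewrite zeval_M' mulrA in Dh.
(* The divisibility of chi(x) by p^t passes to its conjugates chi(x^k). *)
have conj_h k : coprime k n -> m%:R * M'%:R * zeval (z ^+ k) f = p%:R ^+ t * zeval (z ^+ k) h.
  move=> /Qn_aut_exists[nu Dnu]; rewrite -Dnu ?(prim_expr_order pz) //.
  by have := congr1 nu Dh; rewrite !rmorphM rmorphXn !rmorph_nat !aut_zeval.
pose H := h * (h \Po 'X^(n.-1)).
have norm_H k : coprime k n ->
    (m * M')%N%:R ^+ 2 * `|chi (x ^+ k)%g| ^+ 2 = (p%:R ^+ t) ^+ 2 * zeval (z ^+ k) H.
  move=> co_k; rewrite (char_norm_zeval Nchi Df) !rmorphM /= !zeval_comp_Xn -/n.
  have co_k' : coprime (k * n.-1) n by rewrite coprimeMl co_k coprimePn.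
  have := conj_h _ co_k'; rewrite [z ^+ (k * _)]exprM => Dk'.
  have Dk := conj_h _ co_k.
  transitivity ((m%:R * M'%:R * zeval (z ^+ k) f) * (m%:R * M'%:R * zeval (z ^+ k ^+ n.-1) f)).
    by rewrite ?natrM; ring.
  by rewrite Dk Dk'; ring.
have [l Dn /andP[_ le_al]] := aut0_modulusP p_pr p_x.
set Q := aut0_modulus x p in Dn.
have [|H' DH'] := @trace_progression z Q (p ^ l) H; first by rewrite -Dn (prim_expr_order pz).
pose N y : algC := `|chi y| ^+ 2.
have NG : {in G &, forall y g, N (y ^ g)%g = N y} by move=> y g _ Gg; rewrite /N cfunJ.
have := sum_galois_block p_pr Gx p_x Dn NG; rewrite -Dac -/Q.
set T := \sum_(k < _) _ => DB.
have DT : (m * M')%N%:R ^+ 2 * T = (p%:R ^+ t) ^+ 2 * (p%:R ^+ l * zeval z H').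
  rewrite -[p%:R ^+ l]natrX -DH' !mulr_sumr; apply: eq_bigr => k _; apply: norm_H.
  by apply: (coprime_modulus p_pr p_x); rewrite -/Q addnC mulnC modnMDl.
exists ((m * M') ^ 2 * D')%N, (M'%:R * p%:R ^+ (t + l - b) * zeval z H'); split.
- rewrite Euclid_dvdM // Euclid_dvdX // Euclid_dvdM //.
  by rewrite (negPf p'M') (negPf p'D') (negPf (prime_ndvd_p'part _ p_pr)).
- by rewrite !rpredM ?rpredX ?rpred_nat ?Aint_zeval // (Aint_prim_root pz).
rewrite -mulr_suml; set B := \sum_(y in _) _ in DB *.
(* b < v_p(n) <= l + 2, and t >= 1. *)
have le_b : (b <= t + l)%N.
  by rewrite (leq_trans (leq_trans lt_ba le_al : b <= l.+1)%N) // -add1n leq_add2r.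
apply: (mulfI (expf_neq0 t p_nz)); apply: (mulfI (expf_neq0 b p_nz)).
transitivity ((m * M')%N%:R ^+ 2 * (aut0c%:R * c%:R * B / chi 1%g)).
  by rewrite -[aut0c%:R * _]natrM DD' !(natrM, natrX); ring.
have -> : aut0c%:R * c%:R * B / chi 1%g = M%:R * T.
  rewrite -DM -card_cl; transitivity (c%:R * (aut0c%:R * B) / chi 1%g); first by ring.
  by rewrite DB; ring.
rewrite mulrCA DT DM' !(natrM, natrX).
have -> : p%:R ^+ b * (M'%:R * p%:R ^+ (t + l - b) * zeval z H')
  = M'%:R * p%:R ^+ (t + l) * zeval z H' by rewrite -(subnKC le_b) exprD addKn; ring.
by rewrite exprD; ring.
Qed.

(** * Character sums over unions of q-sections *)

Lemma dvdA_natP m x : (0 < m)%N ->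
  reflect (exists2 v, v \in Aint & x = m%:R * v) (m%:R %| x)%A.
Proof.
move=> m_gt0; have m_nz : m%:R != 0 :> algC by rewrite pnatr_eq0 -lt0n.
rewrite /dvdA unfold_in (negPf m_nz); apply: (iffP idP) => [Av | [v Av ->]].
  by exists (x / m%:R) => //; rewrite mulrC divfK.
by rewrite mulrC mulKf.
Qed.

(** The eigenvalues of x are roots of unity of q-power order, congruent to 1
    modulo the uniformizer, so chi(x) is congruent to chi(1); a rational integer
    divisible by the uniformizer is divisible by q. *)
Lemma int_char_pelt_mod (gT : finGroupType) (G : {group gT}) (chi : 'CF(G)) q x (c d : int) :
    prime q -> chi \is a character -> x \in G -> q.-elt x ->
    chi x = c%:~R -> chi 1%g = d%:~R -> (q%:Z %| c - d)%Z.
Proof.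
move=> q_pr Nchi Gx qx Dc Dd.
have [z pz] := C_prim_root_exists (order_gt0 x).
have [f Df] := char_expg_zeval Nchi Gx pz.
have Df1 : f.[1] = d.
  apply: (@intr_inj algC); rewrite -Dd -(expg0 x) Df expr0 /zeval.
  by rewrite -[1 in RHS](rmorph1 intr) horner_map.
have [f' Df'] := zeval_mod_uniformizer z f.
have Dcd : (c - d)%:~R = (1 - z) * zeval z f'.
  by rewrite rmorphB /= -Dc -[x]expg1 Df expr1 Df' Df1 [LHS]addrC addKr.
have Dn : #[x]%g = (q ^ logn q #[x]%g)%N by rewrite -p_part part_pnat_id.
have [a0 | a_gt0] := posnP (logn q #[x]%g).
  move: pz; rewrite Dn a0 expn0 => /prim_expr_order; rewrite expr1 => z1.
  by move/eqP: Dcd; rewrite z1 subrr mul0r intr_eq0 => /eqP->; apply: dvdz0.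
rewrite Dn in pz; have [e [g [h [e_gt0 Dg Dh]]]] := uniformizer_prime_power q_pr a_gt0 pz.
have Az : z \in Aint by apply: Aint_prim_root pz.
apply: (@Aint_prime_dvd_expr q (c - d) e (zeval z g * zeval z f' ^+ e) q_pr).
  by rewrite rpredM ?rpredX ?Aint_zeval.
by rewrite Dcd exprMn Dg mulrA.
Qed.

(** Induce the trivial character of a Sylow q-subgroup. The result vanishes off
    the q-elements, and at q-elements it is an integer prime to q, congruent to
    the index of the Sylow subgroup. By Euler's theorem a suitable power is
    congruent to 1 there modulo the q-part of |G|. *)
Lemma char_approx_pelt (gT : finGroupType) (G : {group gT}) q :
    prime q ->
  exists2 psi : 'CF(G), psi \is a character
    & forall x, x \in G ->
      exists2 m, m \in Aint & psi x = (q.-elt x)%:R + (#|G|`_q)%N%:R * m.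
Proof.
move=> q_pr; have [Q sylQ] := Sylow_exists q G; have [sQG qQ q'GQ] := and3P sylQ.
pose psi0 : 'CF(G) := 'Ind[G, Q] 1; pose N := totient (#|G|`_q)%N.
have N_gt0 : (0 < N)%N by rewrite totient_gt0 part_gt0.
have Npsi0 : psi0 \is a character by rewrite cfInd_char ?cfun1_char.
have psi0E x : x \in G -> psi0 x = #|Q|%:R^-1 * #|[set y in G | (x ^ y)%g \in Q]|%:R.
  move=> Gx; rewrite cfIndE //; congr (_ * _); rewrite -sum1_card natr_sum.
  rewrite [LHS](bigID (fun y => (x ^ y)%g \in Q)) /= [X in _ + X]big1 ?addr0.
    apply: eq_big => [y | y /andP[_ Qxy]]; first by rewrite inE.
    by rewrite cfun1E Qxy.
  by move=> y /andP[_ /negPf nQ]; rewrite cfun1E nQ.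
exists (psi0 ^+ N); first by rewrite rpredX.
move=> x Gx; have -> : (psi0 ^+ N) x = psi0 x ^+ N.
  by rewrite -(prednK N_gt0) expS_cfunE.
have /natrP[c Dc] : psi0 x \in Num.nat.
  rewrite natrEint Cint_rat_Aint ?Aint_char //; last first.
    by rewrite psi0E // rpredM ?rpredV ?rpred_nat.
  by rewrite psi0E // mulr_ge0 ?invr_ge0 ?ler0n.
have [qx | q'x] := boolP (q.-elt x); last first.
  exists 0; rewrite ?Aint0 // psi0E // (_ : [set _ | _ & _] = set0) ?cards0.
    by rewrite mulr0 expr0n eqn0Ngt N_gt0 mulr0 addr0.
  apply/setP=> y; rewrite !inE; apply/negP=> /andP[_ /(mem_p_elt qQ)].
  by rewrite p_eltJ (negPf q'x).
have psi01 : psi0 1%g = #|G : Q|%:R by rewrite cfInd1 // cfun11 mulr1.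
have q_c := @int_char_pelt_mod _ _ psi0 q x c #|G : Q| q_pr Npsi0 Gx qx Dc psi01.
have co_c : coprime c (#|G|`_q)%N.
  rewrite p_part coprimeXr // coprime_sym prime_coprime //.
  apply: contraL q'GQ => q_dv_c; rewrite p'natE // negbK.
  have : (q%:Z %| c%:Z)%Z by [].
  by rewrite -(subrK #|G : Q|%:Z c%:Z) (rpredDl _ q_c).
have := Euler_exp_totient co_c => /eqP; rewrite -/N -eqAmod_nat => Dmod.
have : ((#|G|`_q)%N%:R %| (c ^ N)%N%:R - 1%N%:R)%A by [].
case/(dvdA_natP _ (part_gt0 _ _)) => m Am Dm; exists m => //.
by rewrite -Dm Dc natrX /=; ring.
Qed.

Lemma central_irr_mul (gT : finGroupType) (G : {group gT}) (i : Iirr G) w :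
    w \in 'Z(G)%g ->
  exists2 a, a \in Aint & {in G, forall x, 'chi_i (w * x)%g = a * 'chi_i x}.
Proof.
move=> Zw; have Gw : w \in G by case/setIP: Zw.
have [a Da] : exists a, 'Chi_i w = a%:M.
  apply/is_scalar_mxP; have : w \in 'Z('chi_i)%CF.
    by move: w Zw {Gw}; apply/subsetP; rewrite -cap_cfcenter_irr; apply: bigcap_inf.
  by rewrite -irrRepr cfcenter_repr inE => /andP[].
have mulE : {in G, forall x, 'chi_i (w * x)%g = a * 'chi_i x}.
  move=> x Gx; rewrite -irrRepr !cfunE groupM // Gx !mulr1n.
  by rewrite repr_mxM // Da mul_scalar_mx mxtraceZ.
exists a; last exact: mulE.
apply: (Aint_unity_root (order_gt0 w)).
apply/unity_rootP; apply: (mulIf (irr1_neq0 i)); rewrite mul1r -[in RHS](expg_order w).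
elim: #[w]%g => [|n IHn]; first by rewrite mul1r expg0.
by rewrite expgS mulE ?groupX // -IHn exprS mulrA.
Qed.

(** Up to the scalar by which the central element w acts, the sum over G is |G|
    times an inner product of characters. *)
Lemma char_central_translate_dvd (gT : finGroupType) (G : {group gT}) (phi psi : 'CF(G)) w :
    phi \is a character -> psi \is a character -> w \in 'Z(G)%g ->
  (#|G|%:R %| \sum_(x in G) phi (w * x)%g * psi x)%A.
Proof.
move=> Nphi Npsi Zw; have Gw : w \in G by case/setIP: Zw.
have [r Dr] := char_sum_irr Nphi.
pose T (i : Iirr G) := \sum_(x in G) 'chi_i (w * x)%g * psi x.
have -> : \sum_(x in G) phi (w * x)%g * psi x = \sum_(i <- r) T i.
  rewrite exchange_big /=; apply: eq_bigr => x Gx.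
  by rewrite Dr sum_cfunE mulr_suml.
apply: rpred_sum => i _; apply/(dvdA_natP _ (cardG_gt0 G)).
have [a Aa Da] := central_irr_mul i Zw.
exists (a * '['chi_i, (psi^*)%CF]).
  rewrite rpredM // Aint_Cint // Cint_cfdot_vchar ?char_vchar ?irr_char //.
  by rewrite cfConjC_char.
rewrite cfdotE /T (eq_bigr (fun x => a * ('chi_i x * psi x))) => [|x Gx]; last first.
  by rewrite Da // mulrA.
rewrite -mulr_sumr mulrCA; congr (_ * _); rewrite mulVKf ?neq0CG //.
by apply: eq_bigr => x Gx; rewrite cfunE conjCK.
Qed.

(** The elements with q'-part w are the products w x with x a q-element of the
    centralizer C of w. The indicator function of the q-elements of C may be
    replaced by the character of [char_approx_pelt], at the cost of a multiple
    of the q-part of |C|. *)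
Lemma char_q'section_dvd (gT : finGroupType) (G : {group gT}) (phi : 'CF(G)) q w :
    prime q -> phi \is a character -> w \in G -> q^'.-elt w ->
  ((#|'C_G[w]|`_q)%N%:R %| \sum_(x in G | x.`_q^' == w) phi x)%A.
Proof.
move=> q_pr Nphi Gw q'w; pose C := 'C_G[w]%G.
have Zw : w \in 'Z(C)%g.
  rewrite inE /= inE Gw cent1id /=; apply/centP=> x /setIP[_ /cent1P].
  by move/commute_sym.
have sCG : C \subset G by apply: subsetIl.
have -> : \sum_(x in G | x.`_q^' == w) phi x
    = \sum_(x in C) 'Res[C] phi (w * x)%g * (q.-elt x)%:R.
  rewrite (bigID (fun x => q.-elt x) (mem C)) /= [X in _ = _ + X]big1 ?addr0 => [|x]; last first.
    by case/andP=> _ /negPf->; rewrite mulr0.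
  rewrite (reindex (fun x => w * x)%g) /=; last first.
    by exists (fun x => w^-1 * x)%g => x _; rewrite ?mulKg ?mulKVg.
  have condE x : (w * x \in G)%g && ((w * x).`_q^' == w)%g = (x \in C) && q.-elt x.
    apply/andP/andP=> [[Gwx /eqP Dw] | [/setIP[Gx /cent1P cwx] qx]].
      have Dx : (w * x).`_q%g = x.
        by apply: (mulgI w); rewrite -[RHS](consttC q^') consttNK Dw.
      have cwx : commute w x by rewrite /commute -[in RHS]Dx -[X in _ = (_ * X)%g]Dw consttC.
      rewrite inE -(groupMl x Gw) Gwx -{2}Dx p_elt_constt; split=> //.
      by apply/cent1P; apply: commute_sym.
    rewrite groupM // consttM //; split=> //.
    by rewrite constt_p_elt // (constt1P _) ?mulg1 // p_eltNK.
  rewrite (eq_bigl _ _ condE); apply: eq_bigr => x /andP[Cx ->].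
  by rewrite mulr1 cfResE // groupM //; case/setIP: Zw.
have [psi Npsi Dpsi] := char_approx_pelt C q_pr.
rewrite (eq_bigr (fun x => 'Res[C] phi (w * x)%g * psi x
   - 'Res[C] phi (w * x)%g * (psi x - (q.-elt x)%:R))); last by move=> x _; ring.
rewrite sumrB rpredB //.
  have := char_central_translate_dvd (cfRes_char C Nphi) Npsi Zw.
  case/(dvdA_natP _ (cardG_gt0 C)) => v Av ->; apply/(dvdA_natP _ (part_gt0 _ _)).
  exists ((#|C|`_q^')%N%:R * v); first by rewrite rpredM ?rpred_nat.
  by rewrite mulrA -natrM partnC.
apply: rpred_sum => x Cx; have [m Am ->] := Dpsi x Cx; apply/(dvdA_natP _ (part_gt0 _ _)).
exists ('Res[C] phi (w * x)%g * m); first by rewrite rpredM ?Aint_char ?cfRes_char.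
by rewrite addrC addKr; ring.
Qed.

(** A q-section contributes a multiple of |C_G(w)|_q for each q'-element w, and
    the conjugates of w number |G : C_G(w)|. *)
Lemma char_q'closed_sum_dvd (gT : finGroupType) (G : {group gT}) (phi : 'CF(G)) q
    (S : {set gT}) :
    prime q -> phi \is a character -> S \subset G ->
    {in G &, forall x g, ((x ^ g)%g \in S) = (x \in S)} ->
    {in G, forall x, (x.`_q^' \in S) = (x \in S)} ->
  ((#|G|`_q)%N%:R %| \sum_(x in S) phi x)%A.
Proof.
move=> q_pr Nphi sSG SJ Sq; pose J w := \sum_(x in G | x.`_q^' == w) phi x.
have GS x : x \in S -> x \in G by apply: subsetP.
have -> : \sum_(x in S) phi x = \sum_(w in [set x.`_q^' | x in S]) J w.
  rewrite (partition_big_imset (fun x => x.`_q^')); apply: eq_bigr => _ /imsetP[y Sy ->].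
  apply: eq_bigl => x; apply: andb_id2r => /eqP Dx.
  by apply/idP/idP=> [/GS // | Gx]; rewrite -Sq // Dx Sq // GS.
rewrite (partition_big_imset (fun w => w ^: G)).
apply: rpred_sum => _ /imsetP[_ /imsetP[y Sy ->] ->].
set w := y.`_q^'.
have Sw : w \in S by rewrite Sq ?GS.
have Gw := GS w Sw; have q'w : q^'.-elt w by apply: p_elt_constt.
rewrite (eq_bigl (mem (w ^: G))) => [|v]; last first.
  apply/andP/idP=> [[_ /eqP <-] | /imsetP[g Gg ->]]; first exact: class_refl.
  rewrite classGidl // eqxx; split=> //; apply/imsetP; exists (y ^ g)%g.
    by rewrite SJ // GS.
  by rewrite consttJ.
rewrite (eq_bigr (fun _ => J w)) => [|_ /imsetP[g Gg ->]]; last first.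
  rewrite /J (reindex_inj (conjg_inj g)) /=; apply: eq_big => [x | x _]; last by rewrite cfunJ.
  by rewrite groupJr // consttJ (inj_eq (@conjg_inj _ g)).
rewrite sumr_const -[J w *+ _]mulr_natl -index_cent1.
have [v Av Dv] := dvdA_natP _ (part_gt0 _ _) (char_q'section_dvd q_pr Nphi Gw q'w).
rewrite /J Dv.
apply/(dvdA_natP _ (part_gt0 _ _)).
exists ((#|G : 'C_G[w]|`_q^')%N%:R * v); first by rewrite rpredM ?rpred_nat.
have -> : (#|G|`_q = #|'C_G[w]|`_q * #|G : 'C_G[w]|`_q)%N.
  by rewrite -partnM ?cardG_gt0 ?indexg_gt0 // Lagrange ?subsetIl.
rewrite -[X in X%:R * _ = _](partnC q) ?indexg_gt0 // !natrM; ring.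
Qed.

(** * Integrality of the mass of chi on S *)

(** Raising to a power prime to |G| permutes S, so the sum over S is equal to its
    own average over these exponents, in which Ramanujan sums appear. *)
Lemma rat_sum_char_norm (gT : finGroupType) (G : {group gT}) (chi : 'CF(G))
    (S : {set gT}) :
    chi \is a character -> S \subset G ->
    (forall k, coprime k #|G| -> {in G, forall x, ((x ^+ k)%g \in S) = (x \in S)}) ->
  \sum_(x in S) `|chi x| ^+ 2 \in Crat.
Proof.
move=> Nchi sSG SX; set R := \sum_(x in S) _.
have sumX k : coprime k #|G| -> \sum_(x in S) `|chi (x ^+ k)%g| ^+ 2 = R.
  move=> co_k; have co_Gk : coprime #|G| k by rewrite coprime_sym.
  have xK : {in G, cancel (fun x => x ^+ k)%g (fun x => x ^+ expg_invn G k)%g} by apply: expgK.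
  rewrite [RHS](reindex_onto (fun x => x ^+ k)%g (fun x => x ^+ expg_invn G k)%g).
    apply: eq_bigl => x; apply/idP/andP=> [Sx | [Sxk /eqP Dx]].
      by have Gx := subsetP sSG x Sx; rewrite SX // xK.
    rewrite -(SX k) // -Dx groupX //; exact: (subsetP sSG).
  by move=> x /(subsetP sSG) Gx; rewrite -expgM mulnC expgM xK.
pose K := [pred k : 'I_#|G| | coprime k #|G|].
have K_gt0 : (0 < #|K|)%N.
  have lt1G : (1 %% #|G| < #|G|)%N by rewrite ltn_mod cardG_gt0.
  by apply/card_gt0P; exists (Ordinal lt1G); rewrite inE /= coprime_modl coprime1n.
have K_nz : #|K|%:R != 0 :> algC by rewrite pnatr_eq0 -lt0n.
rewrite -(mulKf K_nz R) rpredM ?rpredV ?rpred_nat //.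
suffices /intrP[m ->] : #|K|%:R * R \in Num.int by rewrite rpred_int.
have -> : #|K|%:R * R = \sum_(x in S) \sum_(k < #|G| | K k) `|chi (x ^+ k)%g| ^+ 2.
  by rewrite exchange_big /= (eq_bigr (fun _ => R)) ?sumr_const ?mulr_natl // => k /sumX.
apply: rpred_sum => x /(subsetP sSG) Gx.
have [z pz] := C_prim_root_exists (order_gt0 x).
have [f /(char_norm_zeval Nchi) Df] := char_expg_zeval Nchi Gx pz.
under eq_bigr do rewrite Df zevalE; rewrite exchange_big /=.
apply: rpred_sum => j _; rewrite -mulr_sumr rpredM ?rpred_int //.
under eq_bigr do rewrite exprAC; apply: Cint_Ramanujan_sum.
have /dvdnP[d ->] := order_dvdG Gx.
by rewrite exprAC mulnC exprM (prim_expr_order pz) !expr1n.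
Qed.

(** The number c below is the sum of |chi|^2 over the elements with large p-part:
    it is a natural number less than |G|, and divisible by |G| one prime power
    at a time. *)
Lemma irr_vanishes_large_order (gT : finGroupType) (G : {group gT}) (chi : 'CF(G))
    (p M : nat) :
    prime p -> chi \in irr G -> #|G|%:R / chi 1%g = M%:R ->
    {in G, forall g, (#|aut0 G g|%:R %| central_char chi g)%A} ->
  {in G, forall g, (logn p M < logn p #[g]%g)%N -> chi g = 0}.
Proof.
move=> p_pr irr_chi DM aut_dvd; set b := logn p M.
have Nchi : chi \is a character by have /irrP[i ->] := irr_chi; apply: irr_char.
have norm_chi : '[chi] = 1 by have /irrP[i ->] := irr_chi; apply: cfnorm_irr.
pose S := [set x in G | (b < logn p #[x]%g)%N].
have sSG : S \subset G by apply/subsetP=> x; rewrite inE => /andP[].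
have p_S x : x \in S -> (p %| #[x]%g)%N.
  rewrite inE => /andP[_ /(leq_ltn_trans (leq0n _))].
  by rewrite logn_gt0 mem_primes => /and3P[].
pose R := \sum_(x in S) `|chi x| ^+ 2.
have /natrP[d Dd] : chi 1%g \in Num.nat by apply: Cnat_char1.
have chi1_nz : chi 1%g != 0 by have /irrP[i ->] := irr_chi; apply: irr1_neq0.
have d_gt0 : (0 < d)%N by rewrite lt0n -(pnatr_eq0 algC) -Dd.
have M_gt0 : (0 < M)%N.
  by rewrite lt0n -(pnatr_eq0 algC) -DM mulf_neq0 ?invr_eq0 ?neq0CG.
have DG : #|G| = (M * d)%N.
  by apply/eqP; rewrite -(eqr_nat algC) natrM -DM -Dd divfK.
have R_rat : R \in Crat.
  apply: rat_sum_char_norm => // k co_k x Gx; rewrite !inE groupX // Gx /=.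
  suffices -> : #[x ^+ k]%g = #[x]%g by [].
  have : coprime #[x]%g k by rewrite coprime_sym (coprime_dvdr (order_dvdG Gx)).
  by rewrite -generator_coprime => /generator_order.
have RE : R = \sum_(x in S) (chi * chi^*%CF) x.
  by apply: eq_bigr => x _; rewrite !cfunE normCK.
have /natrP[c Dc] : R \in Num.nat.
  rewrite natrEint Cint_rat_Aint //=; last first.
    by rewrite RE; apply: rpred_sum => x _; rewrite Aint_char ?rpredM ?cfConjC_char.
  by apply: sumr_ge0 => x _; rewrite exprn_ge0.
have G_c : (#|G| %| c)%N.
  apply/dvdn_partP=> [|q]; first exact: cardG_gt0.
  rewrite /= mem_primes => /andP[q_pr _]; have [-> | q_neq_p] := eqVneq q p; last first.
    suffices : ((#|G|`_q)%N%:R %| R)%A by rewrite Dc -eqAmod0 eqAmod0_nat.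
    rewrite RE; apply: char_q'closed_sum_dvd => //.
    - by rewrite rpredM ?cfConjC_char.
    - by move=> x g Gx Gg; rewrite !inE groupJr // orderJ.
    move=> x Gx; rewrite !inE Gx groupX //=; congr (_ < _)%N.
    rewrite order_constt -[in RHS](partnC q (order_gt0 x)) lognM ?part_gt0 //.
    by rewrite (@logn_coprime p (#[x]%g`_q)) // p_part coprimeXr // prime_coprime //
               dvdn_prime2 // eq_sym.
  (* The property is additive, so that it can be checked block by block. *)
  pose integral_up_to_p' (s : algC) := exists e v,
    [/\ ~~ (p %| e)%N, v \in Aint & e%:R * s = p%:R ^+ b * v].
  have [e [v [p'e Av Dev]]] : integral_up_to_p' (R / chi 1%g).
    rewrite mulr_suml (partition_big_imset (galois_block G p)) /=.
    apply: big_ind => [|s1 s2 [e1 [v1 [p'e1 Av1 D1]]] [e2 [v2 [p'e2 Av2 D2]]]|_ /imsetP[x Sx ->]].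
    - by exists 1%N, 0; rewrite Aint0 mulr0 mulr0 Euclid_dvd1.
    - exists (e1 * e2)%N, (e2%:R * v1 + e1%:R * v2); split.
      + by rewrite Euclid_dvdM // negb_or p'e1.
      + by rewrite rpredD ?rpredM ?rpred_nat.
      transitivity (e2%:R * (e1%:R * s1) + e1%:R * (e2%:R * s2)); first by rewrite natrM; ring.
      by rewrite D1 D2; ring.
    have := Sx; rewrite inE => /andP[Gx lt_b]; have p_x := p_S x Sx.
    rewrite (eq_bigl (mem (galois_block G p x))) => [|y].
      by apply: galois_block_sum_dvd => //; apply: aut_dvd.
    apply/andP/idP=> [[Sy /eqP <-] | xy].
      by apply: galois_block_refl => //; [apply: (subsetP sSG) | apply: p_S].
    have {}xy : y \in galois_block G p x by [].
    have Gy : y \in G by move: xy; rewrite inE => /andP[].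
    rewrite (galois_block_eq p_pr Gx p_x xy) eqxx inE Gy.
    by rewrite (galois_block_order p_pr Gx p_x xy) lt_b.
  have dvd_ec : (d * p ^ b %| e * c)%N.
    have Dv : (e * c)%N%:R = (d * p ^ b)%N%:R * v :> algC.
      rewrite !natrM natrX -Dc -mulrA -Dev Dd; field.
      by rewrite -Dd.
    rewrite -eqAmod0_nat eqAmod0; apply/dvdA_natP; last by exists v.
    by rewrite muln_gt0 d_gt0 expn_gt0 prime_gt0.
  have co_Gpe : coprime (#|G|`_p) e by rewrite p_part coprimeXl // prime_coprime.
  rewrite -(Gauss_dvdr _ co_Gpe); apply: dvdn_trans dvd_ec.
  by rewrite DG partnM // mulnC [(M`_p)%N]p_part dvdn_mul // dvdn_part.
have c0 : c = 0%N.
  apply/eqP; apply: contraLR G_c; rewrite -lt0n => c_gt0; rewrite gtnNdvd //.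
  rewrite -(ltr_nat algC) -Dc; have := norm_chi; rewrite cfdotE => /(canRL (mulVKf (neq0CG G))).
  rewrite mulr1 => <-; rewrite [X in _ < X](big_setID S) /= (setIidPr sSG).
  rewrite /R (eq_bigr _ (fun x _ => normCK (chi x))) ltrDl (big_setD1 1%g) /=; last first.
    by rewrite !inE order1 logn1 ltn0 group1.
  apply: ltr_wpDr; last by rewrite Dd conjC_nat mulr_gt0 ?ltr0n.
  by apply: sumr_ge0 => y _; rewrite -normCK exprn_ge0.
move=> x Gx lt_b; have Sx : x \in S by rewrite inE Gx.
have /psumr_eq0P : R = 0 by rewrite Dc c0.
move=> /(_ (fun y _ => exprn_ge0 2 (normr_ge0 _)) x Sx)/eqP.
by rewrite expf_eq0 normr_eq0 => /eqP.
Qed.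

Theorem theorem5p2 (gT : finGroupType) (G : {group gT}) (chi : 'CF(G))
    (irr_chi : chi \in irr G)
    (dvd_omega : forall g : gT, g \in G ->
       (#|aut0 G g|%:R %| central_char chi g)%A) :
  forall g : gT, g \in G -> chi g != 0 ->
    (#[g]%g%:R %| #|G|%:R / chi 1%g)%C.
Proof.
have [M DM] : exists M : nat, #|G|%:R / chi 1%g = M%:R.
  apply/natrP; have /irrP[i ->] := irr_chi.
  rewrite natrEint divr_ge0 ?ler0n ?char1_ge0 ?irr_char //.
  by have := dvd_irr1_cardG i; rewrite /dvdC unfold_in (negPf (irr1_neq0 i)) andbT.
move=> g Gg nz_chig; rewrite DM dvdC_nat; apply/dvdn_partP=> [|p]; first exact: order_gt0.
rewrite mem_primes => /andP[p_pr _]; rewrite p_part pfactor_dvdn //; last first.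
  rewrite lt0n -(pnatr_eq0 algC) -DM mulf_neq0 ?invr_eq0 ?neq0CG //.
  by have /irrP[i ->] := irr_chi; apply: irr1_neq0.
rewrite leqNgt; apply: contra nz_chig => lt_Mg; apply/eqP.
exact: (irr_vanishes_large_order p_pr irr_chi DM dvd_omega Gg lt_Mg).
Qed.
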